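(* There exists a cubic (i.e. $3$-regular) graph $G$ of girth at least $7$ such that $\alpha_G(\lambda) > \alpha_{H_{3,8}}(\lambda)$ for every real $\lambda > 17$.
   Context: Graphs are finite and simple. For a graph $G$, $i_k(G)$ denotes the number of independent sets of $G$ with exactly $k$ vertices (so $i_0(G)=1$, the empty set being counted). The partition function (independence polynomial) of $G$ is $P_G(\lambda)=\sum_{k\ge 0} i_k(G)\lambda^k$, and the occupancy fraction of $G$ at fugacity $\lambda$ is $\alpha_G(\lambda)=\frac{\lambda P_G'(\lambda)}{|V(G)|\,P_G(\lambda)}$. $H_{3,8}$ denotes the $(3,8)$-cage, i.e. the Tutte–Coxeter graph: the unique cubic graph of girth $8$ on $30$ vertices. *)

(* Defs.v *)
From HB Require Import structures.
From mathcomp Require Import all_boot all_order all_algebra.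
From mathcomp Require Import reals.

Set Implicit Arguments.
Unset Strict Implicit.
Unset Printing Implicit Defensive.

Import Order.TTheory GRing.Theory Num.Theory.

Record sgraph := SGraph {
  vertex :> finType;
  adj : rel vertex;
  adj_sym : symmetric adj;
  adj_irr : irreflexive adj
}.

Definition regular (d : nat) (G : sgraph) : Prop :=
  forall v : G, #|[set w | adj v w]| = d.

(* The bound on n is needed because [ucycle] also accepts [:: x; y] for an edge
   xy, as well as the empty sequence. *)
Definition has_cycle (G : sgraph) (n : nat) : Prop :=
  3 <= n /\ exists2 c : seq G, ucycle (@adj G) c & size c = n.

(* As usual, the girth of an acyclic graph is infinite. *)
Definition girth_at_least (g : nat) (G : sgraph) : Prop :=
  forall n, has_cycle G n -> g <= n.

Definition has_girth (g : nat) (G : sgraph) : Prop :=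
  has_cycle G g /\ girth_at_least g G.

Definition independent (G : sgraph) (S : {set G}) : bool :=
  [forall x in S, forall y in S, ~~ adj x y].

Definition indep_count (G : sgraph) (k : nat) : nat :=
  #|[set S : {set G} | independent S & #|S| == k]|.

Section Occupancy.
Local Open Scope ring_scope.

Definition partition_function (R : realType) (G : sgraph) : {poly R} :=
  \poly_(k < #|G|.+1) (indep_count G k)%:R.

Definition occupancy (R : realType) (G : sgraph) (lam : R) : R :=
  let P := partition_function R G in
  (lam * P^`().[lam]) / (#|G|%:R * P.[lam]).

End Occupancy.

(* The Tutte-Coxeter graph, from its LCF code [-13, -9, 7, -7, 9, 13]^5 (the
   shifts below are reduced modulo 30): a Hamiltonian cycle on Z/30 together
   with one chord at each vertex. It is the unique cubic graph of girth 8 on 30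
   vertices; these properties, though not the uniqueness, are proved below. *)
Definition tc_chord (i : nat) : nat :=
  (i + nth 0 [:: 17; 21; 7; 23; 9; 13] (i %% 6)) %% 30.

Definition tc_adj (i j : nat) : bool :=
  [|| j == i.+1 %% 30, i == j.+1 %% 30 | j == tc_chord i].

Lemma tc_allP (p : pred nat) : all p (iota 0 30) -> forall i : 'I_30, p i.
Proof. by move/allP=> h i; apply: h; rewrite mem_iota /= ltn_ord. Qed.

Lemma tc_sym : symmetric (fun i j : 'I_30 => tc_adj i j).
Proof.
move=> i j; apply/eqP; move: i j.
have: all (fun i => all (fun j => tc_adj i j == tc_adj j i) (iota 0 30))
  (iota 0 30) by vm_compute.
by move/tc_allP => h i; apply: (tc_allP (h i)).
Qed.

Lemma tc_irr : irreflexive (fun i j : 'I_30 => tc_adj i j).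
Proof.
move=> i; apply/negbTE; move: i.
by apply: (@tc_allP (fun i => ~~ tc_adj i i)); vm_compute.
Qed.

Definition tutte_coxeter : sgraph := SGraph tc_sym tc_irr.

Lemma tutte_coxeter_order : #|tutte_coxeter| = 30.
Proof. exact: card_ord. Qed.

Definition tc_nbrs (i : nat) : seq nat := [:: i.+1 %% 30; (i + 29) %% 30; tc_chord i].

Lemma tc_nbrsP (i j : 'I_30) : tc_adj i j = (val j \in tc_nbrs i).
Proof.
apply/eqP; move: i j.
have: all (fun i => all (fun j => tc_adj i j == (j \in tc_nbrs i)) (iota 0 30))
  (iota 0 30) by vm_compute.
by move/tc_allP => h i; apply: (tc_allP (h i)).
Qed.

Lemma tutte_coxeter_cubic : regular 3 tutte_coxeter.
Proof.
move=> v; rewrite cardsE cardE -(size_map val).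
suff /perm_size: perm_eq (map val (enum [pred w : 'I_30 | tc_adj v w])) (tc_nbrs v) by [].
have nbrs_ok : forall i : 'I_30, uniq (tc_nbrs i) && all (ltn^~ 30) (tc_nbrs i).
  by apply: (@tc_allP (fun i => uniq (tc_nbrs i) && all (ltn^~ 30) (tc_nbrs i))); vm_compute.
have /andP[nbrs_uniq /allP nbrs_lt] := nbrs_ok v.
apply: uniq_perm => //; first by rewrite map_inj_uniq ?enum_uniq //; apply: val_inj.
move=> j; apply/mapP/idP => [[i] | j_nbr].
  by rewrite mem_enum inE /= tc_nbrsP => ? ->.
exists (Ordinal (nbrs_lt _ j_nbr)) => //.
by rewrite mem_enum inE tc_nbrsP.
Qed.

Fixpoint tc_walks (n i : nat) : seq (seq nat) :=
  if n is n'.+1 then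
    flatten [seq [seq j :: w | w <- tc_walks n' j] | j <- tc_nbrs i]
  else [:: [::]].

Lemma tc_walksP (p : seq 'I_30) (x : 'I_30) :
  path (fun i j : 'I_30 => tc_adj i j) x p -> map val p \in tc_walks (size p) x.
Proof.
elim: p x => [|y p IHp] x // /andP[xy /IHp py].
apply/flatten_mapP; exists (val y); first by rewrite -tc_nbrsP.
exact: map_f.
Qed.

Lemma tutte_coxeter_girth : has_girth 8 tutte_coxeter.
Proof.
split.
  split=> //; exists (map (inord : nat -> 'I_30) [:: 0; 1; 2; 3; 4; 5; 18; 17]) => //.
  by rewrite /ucycle /= /tc_adj /= !inE -!val_eqE /= !inordK.
move=> n [n_ge3 [[|x p] cyc sz]]; first by rewrite -sz in n_ge3.
rewrite leqNgt; apply/negP => n_lt8.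
pose no_short_cycle (i : nat) := all (fun m => all (fun w =>
    ~~ [&& uniq (i :: w) & tc_adj (last i w) i]) (tc_walks m i)) (iota 2 5).
have short : forall i : 'I_30, no_short_cycle i.
  by apply: (@tc_allP no_short_cycle); vm_compute.
move: cyc; rewrite /ucycle /= rcons_path => /andP[/andP[xp px] uxp].
have p_in : size p \in iota 2 5.
  by rewrite mem_iota; move: n_ge3 n_lt8; rewrite -sz /= !ltnS => -> ->.
have /allP/(_ _ (tc_walksP xp)) := allP (short x) _ p_in.
have -> : uniq (val x :: map val p) by rewrite -map_cons map_inj_uniq //; apply: val_inj.
by rewrite last_map [tc_adj _ _]px.
Qed.

(* Main.v *)
(* Near lambda = infinity the occupancy fraction of a connected cubic bipartite
   graph is governed by the perturbations of its two maximum independent sets;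
   among graphs of girth at least 8 these first differ through the number of
   8-cycles per vertex, and more 8-cycles mean a smaller occupancy fraction. The
   Tutte-Coxeter graph has 3 of them per vertex, and sparser graphs overtake it.
   The bipartite graph of girth 8 on 40 vertices with LCF code [7, 17, 23, 33]^10,
   found by computer search, already does so below 17: writing P and Q for the
   independence polynomials of the Tutte-Coxeter graph and of this graph, all
   coefficients of 30 Q' P - 40 P' Q expanded at lambda = 17 are positive. Both
   polynomials are obtained by scanning the vertices in order and merging the
   partial independent sets that block the same remaining vertices. *)

Require Import Defs.
From mathcomp Require Import all_boot all_order all_algebra.
From mathcomp Require Import reals.
From Stdlib Require BinNat Nnat.
From mathcomp Require Import ring zify.

Set Implicit Arguments.
Unset Strict Implicit.
Unset Printing Implicit Defensive.

Import Order.TTheory GRing.Theory Num.Theory.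

(** * Independence polynomials of induced subgraphs *)

Section InducedPolynomial.
Variables (R : comNzRingType) (G : sgraph).
Local Open Scope ring_scope.

Definition indep_poly (A : {set G}) : {poly R} :=
  \sum_(S : {set G} | independent S && (S \subset A)) 'X^#|S|.

Lemma partition_function_indep_poly :
  \poly_(k < #|G|.+1) (indep_count G k)%:R = indep_poly [set: G].
Proof.
rewrite /indep_poly poly_def.
(* Group the independent sets by size; [inord] loses nothing, as no size exceeds [#|G|]. *)
rewrite (partition_big (fun S : {set G} => inord #|S| : 'I_#|G|.+1) predT) //=.
apply: eq_bigr => k _.
have cond (S : {set G}) : independent S && (S \subset [set: G]) && (inord #|S| == k)
    = (S \in [set S : {set G} | independent S & #|S| == k]).
  by rewrite inE subsetT andbT -val_eqE /= inordK // ltnS max_card.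
rewrite (eq_bigl _ _ cond) (eq_bigr (fun=> 'X^k)).
  by rewrite sumr_const /indep_count scaler_nat.
by move=> S; rewrite inE => /andP[_ /eqP->].
Qed.

Lemma independentU1 (v : G) (S : {set G}) :
  independent (v |: S) = independent S && [disjoint S & [set w | adj v w]].
Proof.
apply/forall_inP/andP => [indS | [/forall_inP indS /pred0P disS] x].
  split.
    apply/forall_inP => x xS; apply/forall_inP => y yS.
    by apply: (forall_inP (indS x _)); rewrite !inE ?xS ?yS orbT.
  apply/pred0P => w /=; rewrite inE; apply/negbTE/negP => /andP[wS].
  by apply/negP; apply: (forall_inP (indS v _)); rewrite !inE ?eqxx ?wS ?orbT.
rewrite !inE => /predU1P xS; apply/forall_inP => y; rewrite !inE => /predU1P yS.
case: xS yS => [->|xS] [->|yS]; first by rewrite adj_irr.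
- by have := disS y; rewrite /= yS inE /= => ->.
- by rewrite adj_sym; have := disS x; rewrite /= xS inE /= => ->.
exact: (forall_inP (indS x xS)).
Qed.

Lemma indep_poly0 : indep_poly set0 = 1.
Proof.
rewrite /indep_poly (big_pred1 set0) ?cards0 ?expr0 // => S.
rewrite subset0 andbC /=; case: eqP => //= ->.
by apply/forall_inP => x; rewrite inE.
Qed.

(** Split the independent sets by whether they contain [v]; deleting [v] from those that do leaves
    exactly the independent subsets of [A] that avoid its neighbours, with one factor 'X lost. *)
Lemma indep_polyU1 (v : G) (A : {set G}) : v \notin A ->
  indep_poly (v |: A) = indep_poly A + 'X * indep_poly (A :\: [set w | adj v w]).
Proof.
move=> vA; rewrite {1}/indep_poly (bigID (fun S : {set G} => v \in S)) /= addrC.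
congr (_ + _).
  apply: eq_bigl => S; rewrite -andbA; congr (_ && _).
  apply/andP/idP => [[/subsetP sub vS] | sub].
    apply/subsetP => x xS; have := sub x xS; rewrite !inE => /predU1P[xv|//].
    by rewrite -xv xS in vS.
  split; first by rewrite (subset_trans sub) ?subsetUr.
  by apply: contra vA => /(subsetP sub).
rewrite (reindex_onto (fun S => v |: S) (fun S => S :\ v)) /=; last first.
  by move=> S /andP[_ vS]; rewrite setD1K.
rewrite /indep_poly mulr_sumr.
have cond (S : {set G}) :
    [&& independent (v |: S), v |: S \subset v |: A, v \in v |: S & (v |: S) :\ v == S]
    = independent S && (S \subset A :\: [set w | adj v w]).
  rewrite independentU1 setU11 /= subsetD -!andbA; congr (_ && _).
  rewrite [RHS]andbC; congr (_ && _).
  apply/andP/idP => [[/subsetP sub /eqP eqS] | sub].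
    apply/subsetP => x xS; have vS : v \notin S by rewrite -eqS !inE eqxx.
    have := sub x; rewrite !inE xS orbT => /(_ isT) /predU1P[xv|//].
    by rewrite xv (negPf vS) in xS.
  split; first exact: setUS.
  by rewrite setU1K //; apply: contra vA => /(subsetP sub).
apply: eq_big => [S | S].
  by rewrite -cond -!andbA.
rewrite -!andbA cond => /andP[_ /subsetP sub].
have vS : v \notin S by apply/negP => /sub; rewrite !inE (negPf vA) andbF.
by rewrite cardsU1 vS exprS.
Qed.

End InducedPolynomial.

(** * Polynomials with natural coefficients as computable lists *)

Definition npoly := seq BinNums.N.

Fixpoint nadd (p q : npoly) : npoly :=
  match p, q with
  | [::], _ => q
  | _, [::] => p
  | a :: p', b :: q' => BinNat.N.add a b :: nadd p' q'
  end.

Definition nscale (a : BinNums.N) (p : npoly) : npoly := map (BinNat.N.mul a) p.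

Definition nmulX (p : npoly) : npoly := BinNums.N0 :: p.

Fixpoint nmul (p q : npoly) : npoly :=
  if p is a :: p' then nadd (nscale a q) (nmulX (nmul p' q)) else [::].

Fixpoint nderiv (p : npoly) : npoly :=
  if p is _ :: p' then nadd p' (nmulX (nderiv p')) else [::].

(** Taylor shift to p(a + X) by Horner's scheme. *)
Fixpoint nshift (a : BinNums.N) (p : npoly) : npoly :=
  if p is c :: p' then
    let q := nshift a p' in nadd (nadd (nscale a q) (nmulX q)) [:: c]
  else [::].

Section NPolySemantics.
Variable R : comNzRingType.
Local Open Scope ring_scope.

Definition nR (c : BinNums.N) : R := (BinNat.N.to_nat c)%:R.

Lemma nRD a b : nR (BinNat.N.add a b) = nR a + nR b.
Proof. by rewrite /nR Nnat.N2Nat.inj_add natrD. Qed.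

Lemma nRM a b : nR (BinNat.N.mul a b) = nR a * nR b.
Proof. by rewrite /nR Nnat.N2Nat.inj_mul natrM. Qed.

Definition poly_of (p : npoly) : {poly R} := Poly (map nR p).

Lemma poly_of_nil : poly_of [::] = 0. Proof. by []. Qed.

Lemma poly_of_cons c p : poly_of (c :: p) = poly_of p * 'X + (nR c)%:P.
Proof. exact: cons_poly_def. Qed.

Lemma poly_of_add p q : poly_of (nadd p q) = poly_of p + poly_of q.
Proof.
elim: p q => [|a p IHp] [|b q]; rewrite ?poly_of_nil ?add0r ?addr0 //=.
rewrite !poly_of_cons IHp nRD polyCD; ring.
Qed.

Lemma poly_of_scale a p : poly_of (nscale a p) = (nR a)%:P * poly_of p.
Proof.
elim: p => [|b p IHp]; rewrite ?poly_of_nil ?mulr0 //=.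
rewrite !poly_of_cons IHp nRM polyCM; ring.
Qed.

Lemma poly_of_mulX p : poly_of (nmulX p) = 'X * poly_of p.
Proof. by rewrite poly_of_cons addr0 mulrC. Qed.

Lemma poly_of_mul p q : poly_of (nmul p q) = poly_of p * poly_of q.
Proof.
elim: p => [|a p IHp]; rewrite ?poly_of_nil ?mul0r //=.
rewrite poly_of_add poly_of_scale poly_of_mulX poly_of_cons IHp; ring.
Qed.

Lemma poly_of_deriv p : poly_of (nderiv p) = (poly_of p)^`().
Proof.
elim: p => [|a p IHp]; rewrite ?poly_of_nil ?deriv0 //=.
rewrite poly_of_add poly_of_mulX poly_of_cons derivD derivC derivM derivX IHp; ring.
Qed.

Lemma poly_of_shift a p x : (poly_of (nshift a p)).[x] = (poly_of p).[nR a + x].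
Proof.
elim: p => [|c p IHp]; rewrite ?poly_of_nil ?horner0 //=.
rewrite !poly_of_add poly_of_scale poly_of_mulX !poly_of_cons poly_of_nil.
rewrite mul0r add0r !(hornerD, hornerM, hornerMX, hornerC, hornerX) IHp; ring.
Qed.

End NPolySemantics.

Lemma poly_of_ge0 (R : realDomainType) p (x : R) :
  (0 <= x -> 0 <= (poly_of R p).[x])%R.
Proof.
move=> x_ge0; elim: p => [|c p IHp]; rewrite ?poly_of_nil ?horner0 // poly_of_cons.
by rewrite !hornerE addr_ge0 ?mulr_ge0 ?ler0n.
Qed.

(** * Computing the independence polynomial vertex by vertex *)

(* A finite formal sum of bit sequences with coefficients in [npoly]: the label
   of a node is the coefficient of the sequence of turns leading to it. *)
Inductive trie := Leaf | Node of npoly & trie & trie.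

Fixpoint merge (t u : trie) : trie :=
  match t, u with
  | Leaf, _ => u
  | _, Leaf => t
  | Node p l r, Node q l' r' => Node (nadd p q) (merge l l') (merge r r')
  end.

Fixpoint tmulX (t : trie) : trie :=
  if t is Node p l r then Node (nmulX p) (tmulX l) (tmulX r) else Leaf.

Fixpoint bits_or (m bs : bitseq) : bitseq :=
  match m, bs with
  | b :: m', c :: bs' => (b || c) :: bits_or m' bs'
  | _, _ => bs
  end.

(** Where the mask has a true bit, both values of that bit become true, so the two subtrees merge on
    the right. *)
Fixpoint tor (m : bitseq) (t : trie) : trie :=
  match t, m with
  | Node p l r, b :: m' =>
      if b then Node p Leaf (merge (tor m' l) (tor m' r))
      else Node p (tor m' l) (tor m' r)
  | _, _ => t
  end.

(** The first bit tells whether the next vertex is blocked. Skipping it is always possible, hence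
    [merge l r]; choosing it requires the free branch [l], blocks its later neighbours [m] and
    raises the size by one. *)
Fixpoint sweep (ms : seq bitseq) (t : trie) : npoly :=
  match t, ms with
  | Leaf, _ => [::]
  | Node p _ _, [::] => p
  | Node _ l r, m :: ms' => sweep ms' (merge (merge l r) (tmulX (tor m l)))
  end.

Definition sweep_from_empty (ms : seq bitseq) : npoly :=
  sweep ms (iter (size ms) (fun t => Node [::] t Leaf) (Node [:: BinNums.Npos BinNums.xH] Leaf Leaf)).

(** Each row lists only later vertices, since the earlier ones are already decided. *)
Fixpoint later_adj (T : Type) (e : rel T) (s : seq T) : seq bitseq :=
  if s is v :: s' then map (e v) s' :: later_adj e s' else [::].

Lemma later_adj_map (T U : Type) (f : T -> U) (e : rel U) (s : seq T) :
  later_adj (fun x y => e (f x) (f y)) s = later_adj e (map f s).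
Proof. by elim: s => //= v s ->; rewrite -map_comp. Qed.

Section SweepCorrect.
Variable R : comNzRingType.
Local Open Scope ring_scope.

(** Linear extension of [f] to formal sums; the trie operations become identities between such
    sums. *)
Fixpoint tsum (t : trie) (f : bitseq -> {poly R}) : {poly R} :=
  if t is Node p l r then
    poly_of R p * f [::] + tsum l (f \o cons false) + tsum r (f \o cons true)
  else 0.

Lemma tsum_merge t u f : tsum (merge t u) f = tsum t f + tsum u f.
Proof.
elim: t u f => [|p l IHl r IHr] [|q l' r'] f /=; rewrite ?add0r ?addr0 //.
rewrite poly_of_add IHl IHr; ring.
Qed.

Lemma tsum_mulX t f : tsum (tmulX t) f = 'X * tsum t f.
Proof.
elim: t f => [|p l IHl r IHr] f; first by rewrite mulr0.
rewrite [LHS]/= poly_of_mulX IHl IHr /=; ring.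
Qed.

Lemma eq_tsum t f g : f =1 g -> tsum t f = tsum t g.
Proof.
elim: t f g => //= p l IHl r IHr f g fg.
by rewrite fg (IHl _ (g \o cons false)) ?(IHr _ (g \o cons true)) // => bs /=; rewrite fg.
Qed.

Lemma tsum_or m t f : tsum (tor m t) f = tsum t (f \o bits_or m).
Proof.
elim: t m f => [|p l IHl r IHr] [|b m] f //=.
by case: b; rewrite /= ?tsum_merge !IHl !IHr ?addr0 ?add0r ?addrA.
Qed.

Lemma tsumD t f g : tsum t (fun bs => f bs + g bs) = tsum t f + tsum t g.
Proof.
elim: t f g => [|p l IHl r IHr] f g /=; first by rewrite addr0.
rewrite (IHl (f \o cons false) (g \o cons false)).
rewrite (IHr (f \o cons true) (g \o cons true)); ring.
Qed.

Lemma tsumZ t f c : tsum t (fun bs => c * f bs) = c * tsum t f.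
Proof.
elim: t f => [|p l IHl r IHr] f /=; first by rewrite mulr0.
rewrite (IHl (f \o cons false)) (IHr (f \o cons true)); ring.
Qed.

Lemma tsum0 t : tsum t (fun=> 0) = 0.
Proof. by elim: t => //= p l IHl r IHr; rewrite mulr0 IHl IHr !addr0. Qed.

(* [bs] marks the remaining vertices that are blocked by a chosen neighbour. *)
Fixpoint completions (ms : seq bitseq) (bs : bitseq) : {poly R} :=
  match ms, bs with
  | [::], [::] => 1
  | m :: ms', b :: bs' =>
      completions ms' bs' + if b then 0 else 'X * completions ms' (bits_or m bs')
  | _, _ => 0
  end.

Lemma sweepE ms t : poly_of R (sweep ms t) = tsum t (completions ms).
Proof.
elim: ms t => [|m ms IHms] [|p l r] //.
  (* [completions] vanishes on bit sequences of the wrong length, so only the root label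
     survives. *)
  rewrite /= mulr1 (eq_tsum _ (g := fun=> 0)) // tsum0.
  by rewrite (eq_tsum _ (g := fun=> 0)) // tsum0 !addr0.
rewrite [LHS]/= IHms !tsum_merge tsum_mulX tsum_or /= mulr0 add0r.
rewrite (eq_tsum r (g := completions ms)); last by move=> bs; rewrite /= addr0.
by rewrite tsumD tsumZ addrAC.
Qed.

Lemma sweep_from_emptyE ms :
  poly_of R (sweep_from_empty ms) = completions ms (nseq (size ms) false).
Proof.
rewrite sweepE; move: (completions ms) => f.
elim: (size ms) f => [|n IHn] f /=.
  by rewrite poly_of_cons poly_of_nil mul0r add0r mul1r !addr0.
by rewrite IHn poly_of_nil mul0r add0r addr0.
Qed.

(** The recursion of [completions] is [indep_polyU1] applied along [s], with blocked vertices
    dropped. *)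
Lemma completions_indep_poly (G : sgraph) (s : seq G) (bs : bitseq) :
  uniq s -> size bs = size s ->
  completions (later_adj (@adj G) s) bs = indep_poly R [set x in mask (map negb bs) s].
Proof.
elim: s bs => [|v s IHs] [|b bs] //=.
  move=> _ _; suff -> : [set x in [::]] = set0 :> {set G} by rewrite indep_poly0.
  by apply/setP => x; rewrite !inE.
move=> /andP[vs us] [sz]; rewrite IHs //; case: b => /=; first by rewrite addr0.
have size_or m : size (bits_or m bs) = size bs.
  by elim: m (bs) => [|c m IHm] [|d ds] //=; rewrite IHm.
rewrite IHs ?size_or //.
have -> : [set x in v :: mask (map negb bs) s] = v |: [set x in mask (map negb bs) s].
  by apply/setP => x; rewrite !inE.
rewrite indep_polyU1; last by rewrite inE; apply: contra vs; apply: mem_mask.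
congr (_ + 'X * indep_poly _ _); apply/setP => x; rewrite !inE.
(* It remains that or-ing the row of [v] into [bs] masks out exactly the neighbours of [v]. *)
elim: s bs sz {vs us IHs size_or} => [|y s IHs] [|c bs] //= sz; first by rewrite andbF.
have {}IHs := IHs _ (succn_inj sz).
case vy: (adj v y); case: c; rewrite //= !inE IHs ?andb_orr //.
  by case: eqP => [->|_]; rewrite ?vy ?andbF.
by case: eqP => [->|_]; rewrite ?vy ?andbF.
Qed.

End SweepCorrect.

Lemma partition_function_sweep (R : realType) (n : nat) (e : rel nat)
    (e_sym : symmetric (fun i j : 'I_n => e i j))
    (e_irr : irreflexive (fun i j : 'I_n => e i j)) :
  partition_function R (SGraph e_sym e_irr)
    = poly_of R (sweep_from_empty (later_adj e (iota 0 n))).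
Proof.
set G := SGraph _ _; pose s : seq G := enum 'I_n.
have -> : later_adj e (iota 0 n) = later_adj (@adj G) s.
  by rewrite (later_adj_map val e s) val_enum_ord.
have sz : size s = size (later_adj (@adj G) s) by elim: (s) => //= v s' ->.
rewrite /partition_function partition_function_indep_poly sweep_from_emptyE.
rewrite completions_indep_poly ?enum_uniq ?size_nseq -?sz //.
congr indep_poly; apply/setP => x.
by rewrite map_nseq mask_true // !inE mem_enum.
Qed.

(** * Graphs given by neighbour lists *)

Lemma ord_allP (n : nat) (p : pred nat) : all p (iota 0 n) -> forall i : 'I_n, p i.
Proof. by move=> /allP h i; apply: h; rewrite mem_iota ltn_ord. Qed.

Fixpoint walks (nbrs : nat -> seq nat) (k i : nat) : seq (seq nat) :=
  if k is k'.+1 then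
    flatten [seq [seq j :: w | w <- walks nbrs k' j] | j <- nbrs i]
  else [:: [::]].

Section NeighbourLists.
Variables (n : nat) (nbrs : nat -> seq nat).
Let e (i j : nat) := j \in nbrs i.

Lemma symmetric_check :
  all (fun i => all (fun j => e i j == e j i) (iota 0 n)) (iota 0 n) ->
  symmetric (fun i j : 'I_n => e i j).
Proof. by move=> /ord_allP h i j; apply/eqP/(ord_allP (h i)). Qed.

Lemma irreflexive_check :
  all (fun i => ~~ e i i) (iota 0 n) -> irreflexive (fun i j : 'I_n => e i j).
Proof. by move=> /ord_allP h i; apply/negbTE. Qed.

Hypotheses (e_sym : symmetric (fun i j : 'I_n => e i j))
  (e_irr : irreflexive (fun i j : 'I_n => e i j)).
Let G := SGraph e_sym e_irr.

Lemma regular_check (d : nat) :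
  all (fun i => count (e i) (iota 0 n) == d) (iota 0 n) -> regular d G.
Proof.
move=> /ord_allP h v; rewrite cardsE cardE /enum_mem -enumT size_filter.
by rewrite -[RHS](eqP (h v)) -val_enum_ord count_map; apply: eq_count.
Qed.

Lemma mem_walks (p : seq 'I_n) (x : 'I_n) :
  path (fun i j : 'I_n => e i j) x p -> map val p \in walks nbrs (size p) x.
Proof.
elim: p x => [|y p IHp] x // /andP[xy /IHp py].
by apply/flatten_mapP; exists (val y); last exact: map_f.
Qed.

(** A cycle rooted at [i] is a walk with one vertex fewer after [i], so the lengths 3, ..., g - 1
    give walks of sizes 2, ..., g - 2. *)
Lemma girth_check (g : nat) :
  all (fun i => all (fun k => all (fun w => ~~ (uniq (i :: w) && e (last i w) i))
    (walks nbrs k i)) (iota 2 (g - 3))) (iota 0 n) ->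
  girth_at_least g G.
Proof.
move=> /ord_allP h m [m_ge3 [[|x p] cyc sz]]; first by rewrite -sz in m_ge3.
rewrite leqNgt; apply/negP => m_ltg.
move: cyc; rewrite /ucycle /= rcons_path => /andP[/andP[xp px] uxp].
have p_in : size p \in iota 2 (g - 3).
  by rewrite mem_iota; move: m_ge3 m_ltg; rewrite -sz /=; lia.
have /allP/(_ _ (mem_walks xp)) := allP (h x) _ p_in.
have -> : uniq (val x :: map val p) by rewrite -map_cons map_inj_uniq //; apply: val_inj.
by rewrite last_map [e _ _]px.
Qed.

End NeighbourLists.

(* LCF notation: a Hamiltonian cycle 0, 1, ..., n - 1 together with chords whose
   lengths are read off [code] periodically. *)
Definition lcf_nbrs (n : nat) (code : seq nat) (i : nat) : seq nat :=
  [:: i.+1 %% n; (i + n.-1) %% n; (i + nth 0 code (i %% size code)) %% n].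

(** Modulo 40, 33 is -7 and 23 is -17, so each chord is read consistently from both ends. *)
Definition cubic40_nbrs := lcf_nbrs 40 [:: 7; 17; 23; 33].

Definition cubic40_adj (i j : nat) := j \in cubic40_nbrs i.

Lemma cubic40_sym : symmetric (fun i j : 'I_40 => cubic40_adj i j).
Proof. by apply: symmetric_check; vm_compute. Qed.

Lemma cubic40_irr : irreflexive (fun i j : 'I_40 => cubic40_adj i j).
Proof. by apply: irreflexive_check; vm_compute. Qed.

Definition cubic40 : sgraph := SGraph cubic40_sym cubic40_irr.

Lemma cubic40_regular : regular 3 cubic40.
Proof. by apply: regular_check; vm_compute. Qed.

Lemma cubic40_girth : girth_at_least 7 cubic40.
Proof. by apply: girth_check; vm_compute. Qed.

(** * Comparison of the occupancy fractions *)

Definition nsub (p q : npoly) : npoly :=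
  [seq BinNat.N.sub (nth BinNums.N0 p i) (nth BinNums.N0 q i) | i <- iota 0 (size p)].

(* The truncated difference of [q] and [p + 1] is genuine exactly when adding it
   back gives [q], so all coefficients of [q - p - 1] are nonnegative. *)
Definition dominates (q p : npoly) : bool :=
  let p1 := nadd p [:: BinNums.Npos BinNums.xH] in q == nadd p1 (nsub q p1).

Lemma dominates_lt (R : realDomainType) (q p : npoly) (x : R) :
  dominates q p -> (0 <= x -> (poly_of R p).[x] < (poly_of R q).[x])%R.
Proof.
move=> /eqP -> x_ge0; rewrite !poly_of_add poly_of_cons poly_of_nil mul0r add0r.
by rewrite !hornerD hornerC -addrA ltrDl ltr_wpDr ?poly_of_ge0 ?ltr01.
Qed.

Lemma partition_function_gt0 (R : realType) (G : sgraph) (x : R) :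
  (0 <= x -> 0 < (partition_function R G).[x])%R.
Proof.
move=> x_ge0; rewrite /partition_function partition_function_indep_poly /indep_poly.
rewrite (bigD1 set0) /=; last first.
  by rewrite sub0set andbT; apply/forall_inP => y; rewrite inE.
rewrite cards0 expr0 hornerD hornerC horner_sum ltr_wpDr ?ltr01 //.
by apply: sumr_ge0 => S _; rewrite hornerXn exprn_ge0.
Qed.

(** After clearing positive denominators and cancelling [x], the claim is n p' q < m q' p at [x]. *)
Lemma occupancy_lt_check (R : realType) (G H : sgraph) (p q : npoly) (m n a : nat) (x : R) :
  partition_function R G = poly_of R p -> partition_function R H = poly_of R q ->
  #|G| = m -> #|H| = n -> 0 < m -> 0 < n ->
  dominates (nshift (BinNat.N.of_nat a) (nscale (BinNat.N.of_nat m) (nmul (nderiv q) p)))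
    (nshift (BinNat.N.of_nat a) (nscale (BinNat.N.of_nat n) (nmul (nderiv p) q))) ->
  (0 < x -> a%:R <= x -> occupancy G x < occupancy H x)%R.
Proof.
move=> PG PH cardG cardH m_gt0 n_gt0 dom x_gt0 ax.
have p_gt0 : (0 < (poly_of R p).[x])%R by rewrite -PG partition_function_gt0 ?ltW.
have q_gt0 : (0 < (poly_of R q).[x])%R by rewrite -PH partition_function_gt0 ?ltW.
rewrite /occupancy PG PH cardG cardH.
(* The shifted polynomials are evaluated at [x - a], which is nonnegative, so comparing coefficients
   suffices. *)
have := dominates_lt dom (_ : 0 <= x - a%:R)%R; rewrite subr_ge0 => /(_ ax).
rewrite !poly_of_shift !poly_of_scale !poly_of_mul !poly_of_deriv.
rewrite /nR !Nnat.Nat2N.id addrC subrK !hornerM !hornerC => lt.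
rewrite ltr_pdivrMr ?mulr_gt0 ?ltr0n // mulrAC ltr_pdivlMr ?mulr_gt0 ?ltr0n //.
rewrite -!mulrA ltr_pM2l //.
by move: lt; rewrite mulrCA [ltRHS]mulrCA.
Qed.

Theorem theorem3p1 :
  exists G : sgraph,
    [/\ regular 3 G,
        girth_at_least 7 G &
        forall (R : realType) (lam : R),
          (17 < lam -> occupancy tutte_coxeter lam < occupancy G lam)%R].
Proof.
exists cubic40; split; [exact: cubic40_regular | exact: cubic40_girth | move=> R x x_gt17].
have x_gt0 : (0 < x)%R by apply: lt_trans x_gt17; rewrite ltr0n.
have PT := partition_function_sweep R tc_sym tc_irr.
have PG := partition_function_sweep R cubic40_sym cubic40_irr.
apply: (occupancy_lt_check (a := 17) PT PG tutte_coxeter_order (card_ord 40) isT isT _ x_gt0).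
  by vm_compute.
exact: ltW.
Qed.
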